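(* Let $\Lambda=\begin{pmatrix}A&0\\ {}_BM_A&B\end{pmatrix}$ be a finite-dimensional lower triangular matrix algebra over an algebraically closed field (so $A$, $B$ are finite-dimensional algebras and $M$ is a finite-dimensional $B$-$A$-bimodule). Set $L=1+\max\{\ell_A(T\otimes_BM)\mid T\in\operatorname{simp}B\}$ and fix $k\ge1$. Then: (a) $k\text{-}\operatorname{ddell}B\le L\bigl(k\text{-}\operatorname{ddell}\Lambda+1\bigr)-1$. (b) If $\operatorname{pd}_AM<\infty$, then $k\text{-}\operatorname{ddell}A\le\operatorname{pd}_AM+k\text{-}\operatorname{ddell}\Lambda$. (c) If $\operatorname{pd}_AM<\infty$, then $k\text{-}\operatorname{ddell}\Lambda\le\max\{k\text{-}\operatorname{ddell}A,\ \operatorname{pd}_AM+1+k\text{-}\operatorname{ddell}B\}$. In particular, if $\operatorname{gl.dim}A\le1$, then $k\text{-}\operatorname{ddell}\Lambda\le k\text{-}\operatorname{ddell}B+2$.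
   Context: All modules are finitely generated right modules; $\operatorname{pd}_AM$ is the projective dimension of $M$ as a right $A$-module, $\ell_A$ is composition length over $A$, and $\operatorname{simp}B$ is the set of simple right $B$-modules. For a finite-dimensional algebra $\Lambda$, $\Omega$ denotes the syzygy endofunctor of the stable category of $\operatorname{mod}\text{-}\Lambda$ (modulo morphisms factoring through projectives), $\Omega^0=\operatorname{id}$; $U$ is a stable retract of $V$ if it is a retract of $V$ in this stable category. For $k\ge1$ and $X\in\operatorname{mod}\text{-}\Lambda$ (with $\inf\emptyset=\infty$): - $k\text{-}\operatorname{dell}_\Lambda X=\inf\{n\ge0\mid \Omega^nX$ is a stable retract of $\Omega^{n+k}Y$ for some $Y\}$; - $k\text{-}\operatorname{ddell}_\Lambda X=\inf\{m\ge0\mid$ there exist $0\le t\le m$ and an exact sequence $0\to C_t\to\cdots\to C_0\to X\to0$ with $(i+k)\text{-}\operatorname{dell}_\Lambda C_i\le m-i$ for $0\le i\le t\}$. $k\text{-}\operatorname{ddell}\Lambda=\sup\{k\text{-}\operatorname{ddell}_\Lambda S\mid S$ a simple right $\Lambda$-module$\}$. An expression on the right-hand side of an inequality is understood to be $\infty$ whenever a derived delooping level occurring in it is infinite. *)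

(* Defs.v *)
From HB Require Import structures.
From mathcomp Require Import all_boot all_order all_algebra all_field.
From mathcomp Require Import boolp classical_sets constructive_ereal ereal.

Set Implicit Arguments.
Unset Strict Implicit.
Unset Printing Implicit Defensive.

Import Order.TTheory GRing.Theory.
Local Open Scope ring_scope.

(* A finitely generated right module over the finite-dimensional K-algebra A:
   over such an algebra this is the same as a right module that is
   finite-dimensional over K.  [ract v a] is v.a; it is K-bilinear.           *)
Record rmodType (K : fieldType) (A : falgType K) := RModType {
  rmod_sort :> vectType K;
  ract : rmod_sort -> A -> rmod_sort;
  ract_linearl : forall a, linear (ract^~ a);
  ract_linearr : forall v, linear (ract v);
  ract1 : forall v, ract v 1 = v;
  ractM : forall v a b, ract v (a * b) = ract (ract v a) b
}.

(* A finite-dimensional B-A-bimodule (on which K acts centrally).             *)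
Record bimodType (K : fieldType) (B A : falgType K) := BimodType {
  bimod_rmod :> rmodType A;
  lact : B -> bimod_rmod -> bimod_rmod;
  lact_linearl : forall m, linear (lact^~ m);
  lact_linearr : forall b, linear (lact b);
  lact1 : forall m, lact 1 m = m;
  lactM : forall b c m, lact (b * c) m = lact b (lact c m);
  lact_ract : forall b m a, ract (lact b m) a = lact b (ract m a)
}.

Section Modules.
Variables (K : fieldType) (A : falgType K).
Implicit Types X Y N P : rmodType A.

Definition ractr N (a : A) (v : N) : N := ract v a.

HB.instance Definition _ N (a : A) :=
  GRing.isLinear.Build K N N *:%R (@ractr N a) (ract_linearl a).

HB.instance Definition _ N (v : N) :=
  GRing.isLinear.Build K A N *:%R (ract v) (ract_linearr v).

Definition is_rhom X Y (f : 'Hom(X, Y)) : Prop :=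
  forall v a, f (ract v a) = ract (f v) a.

Definition is_submod N (U : {vspace N}) : Prop :=
  forall v a, v \in U -> ract v a \in U.

Definition is_simple N : Prop :=
  (fullv : {vspace N}) <> 0%VS /\
  forall U : {vspace N}, is_submod U -> U = 0%VS \/ U = fullv.

Definition is_composition_series N (n : nat) (U : nat -> {vspace N}) : Prop :=
  [/\ U 0%N = 0%VS, U n = fullv,
      forall i, (i <= n)%N -> is_submod (U i) &
      forall i, (i < n)%N -> [/\ (U i <= U i.+1)%VS, U i <> U i.+1 &
        forall W : {vspace N}, is_submod W -> (U i <= W <= U i.+1)%VS ->
          W = U i \/ W = U i.+1]].

Definition comp_length N : nat :=
  xget 0%N [set n | exists U, @is_composition_series N n U].

Definition is_projective P : Prop :=
  forall X Y (g : 'Hom(X, Y)) (f : 'Hom(P, Y)),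
    is_rhom g -> is_rhom f -> limg g = fullv ->
    exists2 h : 'Hom(P, X), is_rhom h & (g \o h)%VF = f.

(* There is an exact sequence 0 -> C t -> ... -> C 0 -> X -> 0; the terms
   C i with i > t are required to vanish.                                     *)
Definition resolves X (t : nat) (C : nat -> rmodType A) : Prop :=
  (forall i, (t < i)%N -> (fullv : {vspace C i}) = 0%VS) /\
  exists (d : forall i, 'Hom(C i.+1, C i)) (e : 'Hom(C 0%N, X)),
    [/\ forall i, is_rhom (d i), is_rhom e, limg e = fullv,
        lker e = limg (d 0%N) & forall i, lker (d i) = limg (d i.+1)].

(* Suprema and infima are taken in the extended rationals \bar rat, where
   inf set0 = +oo.                                                            *)
Definition einf (S : set nat) : \bar rat := ereal_inf [set n%:R%:E | n in S].

Definition pd X : \bar rat :=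
  einf [set n | exists2 C, resolves X n C &
                  forall i, (i <= n)%N -> is_projective (C i)].

Definition gldim : \bar rat := ereal_sup [set x | exists X, x = pd X].

Definition regmod : rmodType A :=
  @RModType K A A (fun v a => v * a)
    (fun a k u v => etrans (mulrDl _ _ _) (congr1 (+%R^~ _) (esym (scalerAl _ _ _))))
    (fun v k a b => etrans (mulrDr _ _ _) (congr1 (+%R^~ _) (esym (scalerAr _ _ _))))
    (@mulr1 A) (@mulrA A).

Section Power.
Variables (N : rmodType A) (n : nat).
Definition pow_act (v : {ffun 'I_n -> N}) (a : A) : {ffun 'I_n -> N} :=
  [ffun i => ract (v i) a].
Fact pow_act_linearl a : linear (pow_act^~ a).
Proof. by move=> k u v; apply/ffunP=> i; rewrite !ffunE [LHS](ract_linearl). Qed.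
Fact pow_act_linearr v : linear (pow_act v).
Proof. by move=> k a b; apply/ffunP=> i; rewrite !ffunE linearP. Qed.
Fact pow_act1 v : pow_act v 1 = v.
Proof. by apply/ffunP=> i; rewrite !ffunE ract1. Qed.
Fact pow_actM v a b : pow_act v (a * b) = pow_act (pow_act v a) b.
Proof. by apply/ffunP=> i; rewrite !ffunE ractM. Qed.
Definition powmod : rmodType A :=
  RModType pow_act_linearl pow_act_linearr pow_act1 pow_actM.
End Power.

Section Submodule.
Variables (N : rmodType A) (U : {vspace N}) (sU : is_submod U).
Definition sub_act (v : subvs_of U) (a : A) : subvs_of U :=
  Subvs (sU a (subvsP v)).
Fact sub_act_linearl a : linear (sub_act^~ a).
Proof. by move=> k u v; apply: val_inj; rewrite /= [LHS](ract_linearl). Qed.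
Fact sub_act_linearr v : linear (sub_act v).
Proof. by move=> k a b; apply: val_inj; rewrite /= linearP. Qed.
Fact sub_act1 v : sub_act v 1 = v.
Proof. by apply: val_inj; rewrite /= ract1. Qed.
Fact sub_actM v a b : sub_act v (a * b) = sub_act (sub_act v a) b.
Proof. by apply: val_inj; rewrite /= ractM. Qed.
Definition submod : rmodType A :=
  RModType sub_act_linearl sub_act_linearr sub_act1 sub_actM.
End Submodule.

(* The quotient N / U, carried by the vector space complement U^C; the
   projection N -> N / U is the projection onto U^C along U.                  *)
Section Quotient.
Variables (N : rmodType A) (U : {vspace N}) (sU : is_submod U).
Definition quo_proj (v : N) : subvs_of (U^C)%VS :=
  vsproj (U^C)%VS (daddv_pi (U^C)%VS U v).
Definition quo_act (v : subvs_of (U^C)%VS) (a : A) : subvs_of (U^C)%VS :=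
  quo_proj (ract (vsval v) a).
Fact quo_proj_linear : linear quo_proj.
Proof. by move=> k u v; rewrite /quo_proj !linearP. Qed.
HB.instance Definition _ :=
  GRing.isLinear.Build K N (subvs_of (U^C)%VS) *:%R quo_proj quo_proj_linear.
Fact quo_cap : (U^C :&: U = 0)%VS.
Proof. by rewrite capvC capv_compl. Qed.
Fact quo_projK v : quo_proj (vsval v) = v.
Proof. by rewrite /quo_proj daddv_pi_id ?subvsP ?vsvalK ?quo_cap. Qed.
Fact quo_decomp v : daddv_pi (U^C)%VS U v + daddv_pi U (U^C)%VS v = v.
Proof. by rewrite daddv_pi_add ?quo_cap // addvC addv_complf memvf. Qed.
Fact quo_proj0 u : u \in U -> quo_proj u = 0.
Proof.
move=> uU; have := quo_decomp u; rewrite (daddv_pi_id (capv_compl U) uU).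
by move=> /(canRL (addrK _)) e; rewrite /quo_proj e subrr linear0.
Qed.
Fact quo_projB v : v - vsval (quo_proj v) \in U.
Proof.
rewrite -{1}(quo_decomp v) /quo_proj vsprojK ?memv_pi //.
by rewrite addrC addKr memv_pi.
Qed.
Fact quo_act_proj v a : quo_act (quo_proj v) a = quo_proj (ract v a).
Proof.
apply/esym/eqP; rewrite -subr_eq0 /quo_act -linearB; apply/eqP.
have -> : ract v a - ract (vsval (quo_proj v)) a
          = ract (v - vsval (quo_proj v)) a.
  by rewrite -[RHS]/(ractr a _) linearB.
exact/quo_proj0/sU/quo_projB.
Qed.
Fact quo_act_linearl a : linear (quo_act^~ a).
Proof.
by move=> k u v; rewrite /quo_act -linearP; congr quo_proj; rewrite [LHS]ract_linearl.
Qed.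
Fact quo_act_linearr v : linear (quo_act v).
Proof. by move=> k a b; rewrite /quo_act !linearP. Qed.
Fact quo_act1 v : quo_act v 1 = v.
Proof. by rewrite /quo_act ract1 quo_projK. Qed.
Fact quo_actM v a b : quo_act v (a * b) = quo_act (quo_act v a) b.
Proof. by rewrite {3}/quo_act quo_act_proj /quo_act ractM. Qed.
Definition quomod : rmodType A :=
  RModType quo_act_linearl quo_act_linearr quo_act1 quo_actM.
End Quotient.

(* The canonical epimorphism from the free module A^(dim X) onto X, given by
   a K-basis of X.                                                            *)
Definition free_cover_fun X (f : powmod regmod (\dim {:X})) : X :=
  \sum_(i < \dim {:X}) ract (vbasis {:X})`_i (f i).
Definition free_cover X : 'Hom(powmod regmod (\dim {:X}), X) :=
  linfun (@free_cover_fun X).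

Fact free_cover_is_linear X : linear (@free_cover_fun X).
Proof.
move=> k u v; rewrite /free_cover_fun scaler_sumr -big_split /=.
by apply: eq_bigr => i _; rewrite !ffunE linearP.
Qed.
HB.instance Definition _ X :=
  GRing.isLinear.Build K (powmod regmod (\dim {:X})) X *:%R
    (@free_cover_fun X) (@free_cover_is_linear X).

Fact free_cover_rhom X : is_rhom (free_cover X).
Proof.
move=> v a; rewrite !lfunE /= /free_cover_fun.
rewrite -[RHS]/(ractr a _) linear_sum.
by apply: eq_bigr => i _; rewrite ffunE; exact: ractM.
Qed.

Fact lker_submod X Y (f : 'Hom(X, Y)) : is_rhom f -> is_submod (lker f).
Proof.
move=> hf v a; rewrite !memv_ker hf => /eqP->.
by rewrite -[ract _ _]/(ractr a _) linear0.
Qed.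

(* Omega on objects: the kernel of the free cover of X.  By Schanuel's lemma
   any other epimorphism from a projective module gives an isomorphic object
   of the stable category.                                                    *)
Definition syzygy X : rmodType A := submod (lker_submod (@free_cover_rhom X)).

Definition factors_through_projective X Y (f : 'Hom(X, Y)) : Prop :=
  exists P (g : 'Hom(X, P)) (h : 'Hom(P, Y)),
    [/\ is_projective P, is_rhom g, is_rhom h & f = (h \o g)%VF].

(* Retracts in the stable category, i.e. modulo the morphisms that factor
   through a projective module.                                               *)
Definition stable_retract X Y : Prop :=
  exists (i : 'Hom(X, Y)) (r : 'Hom(Y, X)),
    [/\ is_rhom i, is_rhom r & factors_through_projective (r \o i - \1)%VF].

Definition dell (k : nat) X : \bar rat :=
  einf [set n | exists Y,
          stable_retract (iter n syzygy X) (iter (n + k) syzygy Y)].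

Definition ddell (k : nat) X : \bar rat :=
  einf [set m | exists t C, [/\ (t <= m)%N, resolves X t C &
          forall i, (i <= t)%N -> (dell (i + k) (C i) <= (m - i)%:R%:E)%E]].

End Modules.

Definition ddell_alg (k : nat) (K : fieldType) (A : falgType K) : \bar rat :=
  ereal_sup [set x | exists2 S : rmodType A, is_simple S & x = ddell k S].

Section Bimodules.
Variables (K : fieldType) (B A : falgType K) (M : bimodType B A).

HB.instance Definition _ (b : B) :=
  GRing.isLinear.Build K M M *:%R (lact b) (lact_linearr b).

Definition lactr (m : M) (b : B) : M := lact b m.
HB.instance Definition _ (m : M) :=
  GRing.isLinear.Build K B M *:%R (lactr m) (lact_linearl m).
End Bimodules.

(* T (x)_B M.  Choosing a K-basis of T identifies T (x)_K M with the power
   M^(dim T); T (x)_B M is the quotient by the span of the elements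
   (t.b) (x) m - t (x) (b.m), where by bilinearity it is enough to let t and b
   range over bases.                                                          *)
Section Tensor.
Variables (K : fieldType) (B A : falgType K) (T : rmodType B).
Variable (M : bimodType B A).

Definition tens (t : T) (m : M) : powmod M (\dim {:T}) :=
  [ffun i => coord (vbasis {:T}) i t *: m].

Definition tens_rel_fun (t : T) (b : B) (m : M) : powmod M (\dim {:T}) :=
  tens (ract t b) m - tens t (lact b m).

Fact tens_linear t : linear (tens t).
Proof.
by move=> k u v; apply/ffunP => i; rewrite !ffunE scalerDr !scalerA mulrC.
Qed.

Fact tens_rel_linear t b : linear (tens_rel_fun t b).
Proof.
move=> k u v; rewrite /tens_rel_fun lact_linearr !tens_linear.
by rewrite scalerBr opprD addrACA.
Qed.
HB.instance Definition _ t b :=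
  GRing.isLinear.Build K M (powmod M (\dim {:T})) *:%R
    (tens_rel_fun t b) (tens_rel_linear t b).

Definition tens_rel : {vspace powmod M (\dim {:T})} :=
  (\sum_(i < \dim {:T}) \sum_(j < \dim {:B})
    limg (linfun (tens_rel_fun (vbasis {:T})`_i (vbasis {:B})`_j)))%VS.

Fact tens_rel_submod : is_submod tens_rel.
Proof.
move=> v a /memv_sumP[w hw ->].
rewrite -[ract _ _]/(ractr a _) linear_sum.
apply: memv_sumr => i _; have /memv_sumP[x hx ->] := hw i isT.
rewrite -[X in X \in _]/(ractr a _) linear_sum.
apply: memv_sumr => j _; have /memv_imgP[m _ ->] := hx j isT.
rewrite lfunE /=; set t := _`_i; set b := _`_j.
suff e : ractr a (tens_rel_fun t b m) = linfun (tens_rel_fun t b) (ract m a).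
  by have := memv_img (linfun (tens_rel_fun t b)) (memvf (ract m a)); rewrite -e.
rewrite lfunE /=; apply/ffunP => l; rewrite !ffunE.
by rewrite -[LHS]/(ractr a _) linearB !linearZ /= -lact_ract.
Qed.

Definition tensor : rmodType A := quomod tens_rel_submod.
End Tensor.

(* The lower triangular matrix algebra (A 0; M B); the triple (a, m, b) is the
   matrix with rows (a 0) and (m b).                                          *)
Section Triangular.
Variables (K : fieldType) (A B : falgType K) (M : bimodType B A).

Definition trimx : Type := (A * M * B)%type.
HB.instance Definition _ := Vector.on trimx.

Definition trimx_one : trimx := (1, 0, 1).
Definition trimx_mul (x y : trimx) : trimx :=
  (x.1.1 * y.1.1, ract x.1.2 y.1.1 + lact x.2 y.1.2, x.2 * y.2).

Fact trimx_mulA : associative trimx_mul.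
Proof.
move=> x y z; congr (_, _, _); rewrite /= ?mulrA //.
rewrite -[ract (_ + _) _]/(ractr _ _) !linearD /= /ractr.
by rewrite lactM ractM lact_ract addrA.
Qed.
Fact trimx_mul1l : left_id trimx_one trimx_mul.
Proof.
move=> [[a m] b]; congr (_, _, _); rewrite /= ?mul1r //.
by rewrite -[ract 0 _]/(ractr _ _) linear0 add0r lact1.
Qed.
Fact trimx_mul1r : right_id trimx_one trimx_mul.
Proof.
by move=> [[a m] b]; congr (_, _, _); rewrite /= ?mulr1 // linear0 addr0 ract1.
Qed.
Fact trimx_mulDl : left_distributive trimx_mul +%R.
Proof.
move=> x y z; congr (_, _, _); rewrite /= ?mulrDl //.
rewrite -[ract (_ + _) _]/(ractr _ _) -[lact (_ + _) _]/(lactr _ _) !linearD.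
exact: addrACA.
Qed.
Fact trimx_mulDr : right_distributive trimx_mul +%R.
Proof.
move=> x y z; congr (_, _, _); rewrite /= ?mulrDr // !linearD.
exact: addrACA.
Qed.
Fact trimx_one_neq0 : trimx_one != 0.
Proof. by apply/eqP => -[/eqP]; rewrite oner_eq0. Qed.
HB.instance Definition _ := GRing.Zmodule_isNzRing.Build trimx
  trimx_mulA trimx_mul1l trimx_mul1r trimx_mulDl trimx_mulDr trimx_one_neq0.

Fact trimx_scaleAl (k : K) (x y : trimx) : k *: (x * y) = (k *: x) * y.
Proof.
congr (_, _, _); rewrite /= ?scalerAl // scalerDr.
rewrite -[ract (_ *: _) _]/(ractr _ _) -[lact (_ *: _) _]/(lactr _ _).
by rewrite !linearZ.
Qed.
HB.instance Definition _ := GRing.Lmodule_isLalgebra.Build K trimx trimx_scaleAl.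

Fact trimx_scaleAr (k : K) (x y : trimx) : k *: (x * y) = x * (k *: y).
Proof. by congr (_, _, _); rewrite /= ?scalerAr // scalerDr !linearZ. Qed.
HB.instance Definition _ := GRing.Lalgebra_isAlgebra.Build K trimx trimx_scaleAr.
HB.instance Definition _ := Algebra_isFalgebra.Build K trimx.
End Triangular.

Definition max_tensor_length (K : fieldType) (A B : falgType K)
    (M : bimodType B A) : nat :=
  supremum 0%N [set n | exists2 T : rmodType B,
                          is_simple T & n = comp_length (tensor T M)].

(* Main.v *)
Require Import Defs.
From HB Require Import structures.
From mathcomp Require Import all_boot all_order all_algebra all_field.
From mathcomp Require Import boolp classical_sets constructive_ereal ereal.

(* A possibly non-unital homomorphism phi : R' -> R induces the exact functor
   E : X |-> X . phi(1) from R-modules to R'-modules. If Omega^q (E R) is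
   projective, then Omega^q E sends maps through projectives to such maps and
   Omega^q E Omega^n = Omega^(n+q) E stably, so that dell, and then ddell, grows
   by at most q under E. The inclusions and projections between A, B and Lam
   give q = 0 for Lam -> A and for B -> Lam, q = pd M for A -> Lam, and
   q = pd M + 1 for Lam -> B. Restricting along a projection and then along the
   inclusion recovers an A- or B-module, and a simple Lam-module is recovered by
   the opposite composite for A or for B. In particular ddell B <= ddell Lam,
   which is stronger than (a).                                               *)

Set Implicit Arguments.
Unset Strict Implicit.
Unset Printing Implicit Defensive.

Import Order.TTheory GRing.Theory Num.Theory.
Local Open Scope ring_scope.

(** * Homomorphisms, projective modules and short exact sequences *)

Section Homs.
Variables (K : fieldType) (A : falgType K).
Implicit Types X Y Z N P Q : rmodType A.

(** Homomorphisms as plain functions, so that composites, pairs and sums can be written as lambda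
    terms; [rlin_of_rhom] and [rhom_of_rlin] translate to and from ['Hom(X, Y)]. *)
Definition rlin X Y (f : X -> Y) : Prop :=
  linear f /\ forall v a, f (ract v a) = ract (f v) a.

Lemma rlin_of_rhom X Y (f : 'Hom(X, Y)) : is_rhom f -> rlin f.
Proof. by move=> hf; split=> // k u v; rewrite linearP. Qed.

Lemma rhom_of_rlin X Y (f : X -> Y) :
  rlin f -> exists2 g : 'Hom(X, Y), is_rhom g & g =1 f.
Proof.
move=> [lf hf]; pose m := GRing.isLinear.Build K X Y *:%R f lf.
pose F : {linear X -> Y} := HB.pack f m.
have E v : linfun F v = f v by rewrite lfunE.
by exists (linfun F) => // v a; rewrite !E.
Qed.

Lemma rlinD X Y (f : X -> Y) (hf : rlin f) u v : f (u + v) = f u + f v.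
Proof. by have := hf.1 1 u v; rewrite !scale1r. Qed.

Lemma rlin0 X Y (f : X -> Y) (hf : rlin f) : f 0 = 0.
Proof. by apply: (addIr (f 0)); rewrite -rlinD // !add0r. Qed.

Lemma rlinZ X Y (f : X -> Y) (hf : rlin f) k u : f (k *: u) = k *: f u.
Proof. by rewrite -[k *: u]addr0 hf.1 (rlin0 hf) addr0. Qed.

Lemma rlinN X Y (f : X -> Y) (hf : rlin f) u : f (- u) = - f u.
Proof. by rewrite -scaleN1r rlinZ // scaleN1r. Qed.

Lemma rlinB X Y (f : X -> Y) (hf : rlin f) u v : f (u - v) = f u - f v.
Proof. by rewrite rlinD // rlinN. Qed.

Lemma ractD X (u v : X) a : ract (u + v) a = ract u a + ract v a.
Proof. by rewrite -[LHS]/(ractr a _) linearD. Qed.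

Lemma ractN X (u : X) a : ract (- u) a = - ract u a.
Proof. by rewrite -[LHS]/(ractr a _) linearN. Qed.

Lemma ract0 X a : ract (0 : X) a = 0.
Proof. by rewrite -[LHS]/(ractr a _) linear0. Qed.

Lemma ractZ X c (u : X) a : ract (c *: u) a = c *: ract u a.
Proof. by rewrite -[LHS]/(ractr a _) linearZ. Qed.

Lemma ract_sum X n (u : 'I_n -> X) a :
  ract (\sum_i u i) a = \sum_i ract (u i) a.
Proof. by rewrite -[LHS]/(ractr a _) linear_sum. Qed.

Lemma rlin_comp X Y Z (f : Y -> Z) (g : X -> Y) :
  rlin f -> rlin g -> rlin (f \o g).
Proof.
by move=> hf hg; split=> [k u v|v a] /=; rewrite ?hg.1 ?hf.1 // hg.2 hf.2.
Qed.

Lemma rlin_id X : rlin (@id X).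
Proof. by split. Qed.

Lemma rlin_zero X Y : rlin (fun _ : X => 0 : Y).
Proof. by split=> [k u v|v a]; rewrite ?scaler0 ?addr0 ?ract0. Qed.

Lemma rlin_add X Y (f g : X -> Y) :
  rlin f -> rlin g -> rlin (fun v => f v + g v).
Proof.
move=> hf hg; split=> [k u v|v a]; last by rewrite hf.2 hg.2 ractD.
by rewrite hf.1 hg.1 scalerDr addrACA.
Qed.

Lemma rlin_opp X Y (f : X -> Y) : rlin f -> rlin (fun v => - f v).
Proof.
move=> hf; split=> [k u v|v a]; last by rewrite hf.2 ractN.
by rewrite hf.1 opprD scalerN.
Qed.

Section DirectSum.
Variables X Y : rmodType A.
Definition dsum_act (v : (X * Y)%type) (a : A) : (X * Y)%type :=
  (ract v.1 a, ract v.2 a).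
Fact dsum_act_linearl a : linear (dsum_act^~ a).
Proof. by move=> k u v; congr (_, _); rewrite /= ractD ractZ. Qed.
Fact dsum_act_linearr v : linear (dsum_act v).
Proof. by move=> k a b; congr (_, _); rewrite /= linearP. Qed.
Fact dsum_act1 v : dsum_act v 1 = v.
Proof. by case: v => x y; rewrite /dsum_act !ract1. Qed.
Fact dsum_actM v a b : dsum_act v (a * b) = dsum_act (dsum_act v a) b.
Proof. by rewrite /dsum_act !ractM. Qed.
Definition dsum : rmodType A :=
  RModType dsum_act_linearl dsum_act_linearr dsum_act1 dsum_actM.
End DirectSum.

Lemma rlin_fst X Y : rlin (fun v : dsum X Y => v.1).
Proof. by split. Qed.

Lemma rlin_snd X Y : rlin (fun v : dsum X Y => v.2).
Proof. by split. Qed.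

Lemma rlin_pair Z X Y (f : Z -> X) (g : Z -> Y) :
  rlin f -> rlin g -> rlin (fun v => (f v, g v) : dsum X Y).
Proof.
by move=> hf hg; split=> [k u v|v a]; rewrite ?hf.1 ?hg.1 // hf.2 hg.2.
Qed.

Lemma rlin_copair Z X Y (f : X -> Z) (g : Y -> Z) :
  rlin f -> rlin g -> rlin (fun v : dsum X Y => f v.1 + g v.2).
Proof.
move=> hf hg; apply: rlin_add.
  exact: rlin_comp hf (rlin_fst _ _).
exact: rlin_comp hg (rlin_snd _ _).
Qed.

(** Injectivity of [a] makes any pointwise choice of preimages a homomorphism. This serves as the
    universal property of kernels. *)
Lemma rlin_factor X Y Z (a : Y -> Z) (f : X -> Z) :
  rlin a -> injective a -> rlin f -> (forall v, exists u, a u = f v) ->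
  exists2 g : X -> Y, rlin g & forall v, a (g v) = f v.
Proof.
move=> ha ia hf /choice[g hg]; exists g => //; split=> [k u v|v b]; apply: ia.
  by rewrite hg ha.1 !hg hf.1.
by rewrite hg ha.2 hg hf.2.
Qed.

Definition onto (U V : Type) (f : U -> V) : Prop := forall y, exists x, f x = y.

Lemma limg_onto X Y (f : 'Hom(X, Y)) : limg f = fullv <-> onto f.
Proof.
split=> [e y|h].
  have : y \in limg f by rewrite e memvf.
  by case/memv_imgP=> x _ ->; exists x.
apply/vspaceP=> y; rewrite memvf; have [x <-] := h y.
by rewrite memv_img ?memvf.
Qed.

Lemma projective_lift P : is_projective P <->
  forall X Y (g : X -> Y) (f : P -> Y), rlin g -> rlin f -> onto g ->
    exists2 h : P -> X, rlin h & forall v, g (h v) = f v.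
Proof.
split=> hP X Y g f hg hf sg.
  have [g' rg' eg] := rhom_of_rlin hg; have [f' rf' ef] := rhom_of_rlin hf.
  have [|h rh e] := hP _ _ g' f' rg' rf'.
    by apply/limg_onto => y; have [x <-] := sg y; exists x; rewrite eg.
  exists h; first exact: rlin_of_rhom.
  by move=> v; rewrite -ef -e comp_lfunE eg.
have [h hh e] := hP _ _ _ _ (rlin_of_rhom hg) (rlin_of_rhom hf)
  ((limg_onto _).1 sg).
have [h' rh' eh] := rhom_of_rlin hh.
by exists h' => //; apply/lfunP=> v; rewrite comp_lfunE eh e.
Qed.

Lemma projective_dsum P Q :
  is_projective P -> is_projective Q -> is_projective (dsum P Q).
Proof.
move=> /projective_lift hP /projective_lift hQ; apply/projective_lift.
move=> X Y g f hg hf sg.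
have [|u hu eu] := hP _ _ g (fun p => f (p, 0)) hg _ sg.
  exact: (rlin_comp hf (rlin_pair (rlin_id P) (rlin_zero P Q))).
have [|w hw ew] := hQ _ _ g (fun q => f (0, q)) hg _ sg.
  exact: (rlin_comp hf (rlin_pair (rlin_zero Q P) (rlin_id Q))).
exists (fun v => u v.1 + w v.2); first exact: rlin_copair.
move=> [p q] /=; rewrite rlinD // eu ew /= -(rlinD hf).
by congr f; congr (_, _); rewrite /= ?addr0 ?add0r.
Qed.

Lemma pow_act_rlin N n (x : 'I_n -> N) :
  rlin (fun v : powmod (regmod A) n => \sum_i ract (x i) (v i)).
Proof.
split=> [k u v|v a].
  rewrite scaler_sumr -big_split /=; apply: eq_bigr => i _.
  by rewrite !ffunE linearP.
rewrite ract_sum; apply: eq_bigr => i _; rewrite ffunE; exact: ractM.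
Qed.

(** A homomorphism out of a free module is determined by its values on the unit vectors [b i], so it
    suffices to lift those. *)
Lemma projective_free n : is_projective (powmod (regmod A) n).
Proof.
apply/projective_lift => X Y g f hg hf sg.
pose b i : powmod (regmod A) n := [ffun j => (j == i)%:R].
have /choice[x hx] : forall i, exists x, g x = f (b i) by move=> i; apply: sg.
exists (fun v : powmod (regmod A) n => \sum_i ract (x i) (v i)); first exact: pow_act_rlin.
move=> v.
have gsum m (u : 'I_m -> X) : g (\sum_i u i) = \sum_i g (u i).
  elim: m u => [|m IH] u; first by rewrite !big_ord0 rlin0.
  by rewrite !big_ord_recr /= rlinD // IH.
have fsum m (u : 'I_m -> powmod (regmod A) n) :
    f (\sum_i u i) = \sum_i f (u i).
  elim: m u => [|m IH] u; first by rewrite !big_ord0 rlin0.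
  by rewrite !big_ord_recr /= rlinD // IH.
rewrite gsum [v in RHS](_ : _ = \sum_i ract (b i) (v i)).
  by rewrite fsum; apply: eq_bigr => i _; rewrite hg.2 hx hf.2.
apply/ffunP => j; rewrite sum_ffunE (bigD1 j) //= !ffunE eqxx.
rewrite [ract _ _]mul1r big1 ?addr0 // => i ij.
by rewrite !ffunE eq_sym (negPf ij) [ract _ _]mul0r.
Qed.

Lemma projective_reg : is_projective (regmod A).
Proof.
apply/projective_lift => X Y g f hg hf sg; have [x hx] := sg (f 1).
exists (fun a => ract x a).
  by split=> [k u v|v a]; [rewrite linearP | exact: ractM].
by move=> v; rewrite hg.2 hx -hf.2; congr f; apply: mul1r.
Qed.

Definition short_exact X Y Z : Prop := exists (f : X -> Y) (g : Y -> Z),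
  [/\ rlin f, rlin g, injective f, onto g &
      forall y, g y = 0 <-> exists x, f x = y].

Lemma rlin_vsval X (U : {vspace X}) (sU : is_submod U) :
  rlin (vsval : submod sU -> X).
Proof. by split=> // k u v; rewrite linearP. Qed.

Lemma kernel_short_exact X Y (f : 'Hom(X, Y)) (hf : is_rhom f) :
  onto f -> short_exact (submod (lker_submod hf)) X Y.
Proof.
move=> sf; exists vsval, f; split; first exact: rlin_vsval.
- exact: rlin_of_rhom.
- exact: val_inj.
- by move=> y; have [x <-] := sf y; exists x.
move=> y; split=> [fy|[x <-]]; last by apply/eqP; rewrite -memv_ker subvsP.
have hy : y \in lker f by rewrite memv_ker fy.
by exists (Subvs hy).
Qed.

Lemma syzygy_short_exact X :
  short_exact (syzygy X) (powmod (regmod A) (\dim {:X})) X.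
Proof.
apply: kernel_short_exact => x.
exists [ffun i => coord (vbasis {:X}) i x *: 1].
rewrite lfunE /= /free_cover_fun.
rewrite [RHS](coord_vbasis (memvf x)); apply: eq_bigr => i _.
by rewrite ffunE linearZ /= ract1.
Qed.

(* [id_X + h g = r i] with [g], [h] passing through [N]: [X] is a retract of
   [Y (+) N].                                                                *)
Definition retract_mod N X Y : Prop :=
  exists (i : X -> Y) (r : Y -> X) (g : X -> N) (h : N -> X),
    [/\ rlin i, rlin r, rlin g, rlin h & forall v, r (i v) = v + h (g v)].

(** Keeping [N] arbitrary in [retract_mod] also allows error terms through modules that are merely
    of finite projective dimension. *)
Lemma stable_retractP X Y : stable_retract X Y <->
  exists2 P, is_projective P & retract_mod P X Y.
Proof.
split=> [[i [r [hi hr [P [g [h [hP hg hh e]]]]]]]|].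
  exists P => //; exists i, r, g, h; split; try exact: rlin_of_rhom.
  move=> v; have /lfunP/(_ v) := e.
  by rewrite !lfun_simp => <-; rewrite addrCA subrr addr0.
move=> [P hP [i [r [g [h [hi hr hg hh e]]]]]].
have [i' ri ei] := rhom_of_rlin hi; have [r' rr er] := rhom_of_rlin hr.
have [g' rg eg] := rhom_of_rlin hg; have [h' rh eh] := rhom_of_rlin hh.
exists i', r'; split=> //; exists P, g', h'; split=> //.
by apply/lfunP=> v; rewrite !lfun_simp ei er eg eh e addrC addKr.
Qed.
End Homs.

(** * Stable retracts, syzygies and projective dimension *)

Section Syzygies.
Variables (K : fieldType) (A : falgType K).
Implicit Types X Y Z N P Q : rmodType A.

Lemma projective_retract P X Y :
  is_projective P -> is_projective Y -> retract_mod P X Y -> is_projective X.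
Proof.
move=> /projective_lift hP /projective_lift hY [i [r [g [h [hi hr hg hh e]]]]].
apply/projective_lift => U V p f hp hf sp.
have [u hu eu] := hY _ _ p _ hp (rlin_comp hf hr) sp.
have [w hw ew] := hP _ _ p _ hp (rlin_comp hf hh) sp.
(* Since [v = r (i v) - h (g v)], the two terms are lifted separately, through the projectives [Y]
   and [P]. *)
exists (fun v => u (i v) - w (g v)).
  exact: rlin_add (rlin_comp hu hi) (rlin_opp (rlin_comp hw hg)).
by move=> v; rewrite rlinB // eu ew /= -rlinB // e addrK.
Qed.

Lemma stable_refl X : stable_retract X X.
Proof.
apply/stable_retractP; exists (regmod A); first exact: projective_reg.
exists id, id, (fun=> 0), (fun=> 0); split=> [||||v]; try exact: rlin_id.
- exact: rlin_zero.
- exact: rlin_zero.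
- by rewrite addr0.
Qed.

Lemma retract_stable X Y (i : X -> Y) (r : Y -> X) :
  rlin i -> rlin r -> cancel i r -> stable_retract X Y.
Proof.
move=> hi hr c; apply/stable_retractP.
exists (regmod A); first exact: projective_reg.
exists i, r, (fun=> 0), (fun=> 0); split=> // [||v]; try exact: rlin_zero.
by rewrite c addr0.
Qed.

Lemma retract_mod_trans N N' X Y Z :
  retract_mod N X Y -> retract_mod N' Y Z -> retract_mod (dsum N N') X Z.
Proof.
move=> [i [r [g [h [hi hr hg hh e]]]]] [i' [r' [g' [h' [hi' hr' hg' hh' e']]]]].
exists (i' \o i), (r \o r'), (fun v => (g v, g' (i v))),
  (fun w => h w.1 + r (h' w.2)).
split=> [||||v] /=; try exact: rlin_comp.
- exact: rlin_pair hg (rlin_comp hg' hi).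
- exact: rlin_copair hh (rlin_comp hr hh').
- by rewrite e' rlinD // e addrA.
Qed.

Lemma stable_trans Y X Z :
  stable_retract X Y -> stable_retract Y Z -> stable_retract X Z.
Proof.
move=> /stable_retractP[P hP rP] /stable_retractP[Q hQ rQ].
apply/stable_retractP; exists (dsum P Q); first exact: projective_dsum.
exact: retract_mod_trans rP rQ.
Qed.

Lemma projective_stable X Y :
  stable_retract X Y -> is_projective Y -> is_projective X.
Proof. by move=> /stable_retractP[P hP hr] hY; apply: projective_retract hr. Qed.

Definition stable_equiv X Y : Prop := stable_retract X Y /\ stable_retract Y X.

Lemma stable_equiv_trans Y X Z :
  stable_equiv X Y -> stable_equiv Y Z -> stable_equiv X Z.
Proof.
by move=> [h1 h2] [h3 h4]; split; [apply: stable_trans h3|apply: stable_trans h2].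
Qed.

Lemma stable_equiv_sym X Y : stable_equiv X Y -> stable_equiv Y X.
Proof. by case. Qed.

Lemma stable_equiv_dsum X P : is_projective P -> stable_equiv (dsum X P) X.
Proof.
move=> hP; split; last first.
  apply: (@retract_stable _ _ (fun x => (x, 0) : dsum X P) (fun v => v.1)) => //.
  exact: rlin_pair (rlin_id _) (rlin_zero _ _).
apply/stable_retractP; exists P => //.
(* The composite kills the second coordinate; the error [(0, - p)] passes through [P]. *)
exists (fun v => v.1), (fun x => (x, 0)), (fun v => v.2), (fun p => (0, - p)).
split.
- exact: rlin_fst.
- exact: rlin_pair (rlin_id _) (rlin_zero _ _).
- exact: rlin_snd.
- exact: rlin_pair (rlin_zero _ _) (rlin_opp (rlin_id _)).
by move=> [x p]; congr (_, _); rewrite /= ?addr0 ?subrr.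
Qed.

(** A section [s] of [g] makes [y - s (g y)] a retraction onto [X], and the error [- s (g y)] passes
    through [P]. *)
Lemma short_exact_split X Y P :
  is_projective P -> short_exact X Y P -> stable_equiv X Y.
Proof.
move=> hP [f [g [hf hg injf sg ex]]].
have [s hs gs] := (projective_lift P).1 hP _ _ g id hg (rlin_id P) sg.
have [|v|p hp ep] := @rlin_factor _ _ Y X Y f (fun y => y - s (g y)) hf injf.
- exact: rlin_add (rlin_id _) (rlin_opp (rlin_comp hs hg)).
- by apply/ex; rewrite rlinB // gs subrr.
split; last first.
  apply/stable_retractP; exists P => //.
  exists p, f, g, (fun v => - s v); split=> //; first exact: rlin_opp.
apply: retract_stable hf hp _ => x; apply: injf.
have gf : g (f x) = 0 by apply/ex; exists x.
by rewrite ep /= gf rlin0 ?subr0.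
Qed.

(* [P] is a cover of [Z]; together with [X], a lift of it to [Y] covers [Y]. *)
Lemma short_exact_rotate X Y Z : short_exact X Y Z ->
  exists2 P, is_projective P & short_exact (syzygy Z) (dsum X P) Y.
Proof.
move=> [f [g [hf hg injf sg exfg]]].
have [j [p [hj hp injj sp exjp]]] := syzygy_short_exact Z.
have hP := @projective_free _ A (\dim {:Z}).
exists (powmod (regmod A) (\dim {:Z})) => //.
have [l hl el] := (projective_lift _).1 hP _ _ g p hg hp sg.
have [|v|q hq eq] := @rlin_factor _ _ _ _ _ f (fun v => - l (j v)) hf injf.
- exact: rlin_opp (rlin_comp hl hj).
- by apply/exfg; rewrite rlinN // el (_ : p (j v) = 0) ?oppr0 //; apply/exjp; exists v.
exists (fun v => (q v, j v)), (fun w => f w.1 + l w.2); split.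
- exact: rlin_pair.
- exact: rlin_copair.
- by move=> u v [_ /injj].
- move=> y; have [w hw] := sp (g y).
  have /exfg[x hx] : g (y - l w) = 0 by rewrite rlinB // el hw subrr.
  by exists (x, w); rewrite /= hx subrK.
move=> [x w] /=; split=> [/eqP|[v [<- <-]]]; last by rewrite eq addNr.
rewrite addr_eq0 => /eqP exw.
have /exjp[v hv] : p w = 0.
  by rewrite -el -[l w]opprK -exw rlinN // (_ : g (f x) = 0) ?oppr0 //; apply/exfg; exists x.
by exists v; congr (_, _) => //; apply: injf; rewrite eq hv exw.
Qed.

(** Comparison of covers: [P] is projective, so [f] lifts to [f1], which then restricts to the
    kernels. The covers are parameters, fixed once for all four maps of a retract. *)
Lemma syzygy_lift X Y P Q (j : syzygy X -> P) (p : P -> X)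
    (j' : syzygy Y -> Q) (p' : Q -> Y) (f : X -> Y) :
    is_projective P -> rlin j -> rlin p -> (forall v, p (j v) = 0) ->
    rlin j' -> rlin p' -> injective j' -> onto p' ->
    (forall w, p' w = 0 <-> exists v, j' v = w) -> rlin f ->
  exists (f1 : P -> Q) (f2 : syzygy X -> syzygy Y),
    [/\ rlin f1, rlin f2, forall v, p' (f1 v) = f (p v) &
        forall v, j' (f2 v) = f1 (j v)].
Proof.
move=> hP hj hp pj hj' hp' injj' sp' ex' hf.
have [f1 hf1 e1] := (projective_lift P).1 hP _ _ p' _ hp' (rlin_comp hf hp) sp'.
have [|v|f2 hf2 e2] := @rlin_factor _ _ _ _ _ j' (f1 \o j) hj' injj'.
- exact: rlin_comp.
- by apply/ex'; rewrite /= e1 /= pj rlin0.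
by exists f1, f2.
Qed.

Lemma retract_mod_syzygy N X Y : retract_mod N X Y ->
  exists2 P, is_projective P &
    retract_mod (dsum (syzygy N) P) (syzygy X) (syzygy Y).
Proof.
move=> [i [r [g [h [hi hr hg hh e]]]]].
have [j [p [hj hp injj sp ex]]] := syzygy_short_exact X.
have [jY [pY [hjY hpY injjY spY exY]]] := syzygy_short_exact Y.
have [jN [pN [hjN hpN injjN spN exN]]] := syzygy_short_exact N.
have hP := @projective_free _ A (\dim {:X}).
have hQ := @projective_free _ A (\dim {:Y}).
have hS := @projective_free _ A (\dim {:N}).
have pj v : p (j v) = 0 by apply/ex; exists v.
have pjY v : pY (jY v) = 0 by apply/exY; exists v.
have pjN v : pN (jN v) = 0 by apply/exN; exists v.
have [i1 [i2 [hi1 hi2 ei1 ei2]]] := syzygy_lift hP hj hp pj hjY hpY injjY spY exY hi.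
have [r1 [r2 [hr1 hr2 er1 er2]]] := syzygy_lift hQ hjY hpY pjY hj hp injj sp ex hr.
have [g1 [g2 [hg1 hg2 eg1 eg2]]] := syzygy_lift hP hj hp pj hjN hpN injjN spN exN hg.
have [h1 [h2 [hh1 hh2 eh1 eh2]]] := syzygy_lift hS hjN hpN pjN hj hp injj sp ex hh.
(* [t] lifts the zero map [r i - 1 - h g] to the free cover of [X], so it takes values in the
   syzygy. Its corestriction [s] gives the new error term [s \o j], which passes through that free
   cover. *)
pose t v := r1 (i1 v) - v - h1 (g1 v).
have [|v|s hs es] := @rlin_factor _ _ _ _ _ j t hj injj.
- apply: rlin_add (rlin_add (rlin_comp hr1 hi1) (rlin_opp (rlin_id _))) _.
  exact: rlin_opp (rlin_comp hh1 hg1).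
- apply/ex; rewrite /t rlinB // rlinB // er1 ei1 e eh1 eg1.
  by rewrite -addrA -opprD subrr.
exists (powmod (regmod A) (\dim {:X})) => //; exists i2, r2, (fun v => (g2 v, j v)), (fun w => h2 w.1 + s w.2).
split=> //; [exact: rlin_pair|exact: rlin_copair|].
move=> v; apply: injj; rewrite er2 ei2 /= !(rlinD hj) eh2 eg2 es /t.
by rewrite [h1 _ + _]addrC subrK addrC subrK.
Qed.

Lemma syzygy_projective P : is_projective P -> is_projective (syzygy P).
Proof.
move=> hP; have [h _] := short_exact_split hP (syzygy_short_exact P).
by apply: projective_stable h _; apply: projective_free.
Qed.

Lemma syzygy_stable X Y :
  stable_retract X Y -> stable_retract (syzygy X) (syzygy Y).
Proof.
move=> /stable_retractP[P hP /retract_mod_syzygy[Q hQ h]].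
apply/stable_retractP; exists (dsum (syzygy P) Q) => //.
exact/projective_dsum/hQ/syzygy_projective.
Qed.

Lemma syzygyn_stable n X Y :
  stable_retract X Y -> stable_retract (iter n (@syzygy _ _) X) (iter n (@syzygy _ _) Y).
Proof. by move=> h; elim: n => //= n; exact: syzygy_stable. Qed.

Lemma syzygyn_equiv n X Y :
  stable_equiv X Y -> stable_equiv (iter n (@syzygy _ _) X) (iter n (@syzygy _ _) Y).
Proof. by case=> h h'; split; apply: syzygyn_stable. Qed.

(** Projective dimension at most [q], stated with syzygies so that it passes to stable retracts;
    [pd_finite] extracts it from a finite [pd]. *)
Definition pd_le q X : Prop := is_projective (iter q (@syzygy _ _) X).

Lemma pd_le_stable q X Y : stable_retract X Y -> pd_le q Y -> pd_le q X.
Proof. by move=> /(@syzygyn_stable q); apply: projective_stable. Qed.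

Lemma pd_le_projective q P : is_projective P -> pd_le q P.
Proof. by move=> hP; elim: q => //= q; exact: syzygy_projective. Qed.

(** Each syzygy lowers the bound on the projective dimension of the module carrying the error by
    one; after [q] of them that module is projective. *)
Lemma syzygyn_retract_mod q N X Y : pd_le q N -> retract_mod N X Y ->
  stable_retract (iter q (@syzygy _ _) X) (iter q (@syzygy _ _) Y).
Proof.
elim: q N X Y => [|q IH] N X Y; first by move=> *; apply/stable_retractP; exists N.
rewrite /pd_le !iterSr => hN /retract_mod_syzygy[P hP].
by apply: IH; apply: pd_le_stable hN; have [] := stable_equiv_dsum (syzygy N) hP.
Qed.

Lemma pd_le_retract_mod q N X Y :
  pd_le q N -> pd_le q Y -> retract_mod N X Y -> pd_le q X.
Proof.
by move=> hN hY /(syzygyn_retract_mod hN) h; apply: projective_stable hY.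
Qed.

(* Rotating three times yields an extension of the syzygies, up to projective
   summands.                                                                 *)
Lemma short_exact_syzygyn q X Y Z : pd_le q Y -> short_exact X Y Z ->
  stable_equiv (iter q (@syzygy _ _) X) (iter q.+1 (@syzygy _ _) Z).
Proof.
elim: q X Y Z => [|q IH] X Y Z hY ex.
  have [P hP ex1] := short_exact_rotate ex.
  apply: stable_equiv_trans (stable_equiv_sym (stable_equiv_dsum X hP)) _.
  exact/stable_equiv_sym/(short_exact_split hY ex1).
have [P hP ex1] := short_exact_rotate ex.
have [Q hQ ex2] := short_exact_rotate ex1.
have [S hS ex3] := short_exact_rotate ex2.
have hY' : pd_le q (dsum (syzygy Y) S).
  rewrite /pd_le iterSr in hY; apply: pd_le_stable hY.
  by have [] := stable_equiv_dsum (syzygy Y) hS.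
have := IH _ _ _ hY' ex3; rewrite !iterSr => h.
have e1 : stable_equiv (syzygy X) (syzygy (dsum X P)).
  by apply: (@syzygyn_equiv 1); apply/stable_equiv_sym/stable_equiv_dsum.
apply: stable_equiv_trans (syzygyn_equiv q e1) _.
apply: stable_equiv_trans h _.
by apply: syzygyn_equiv; apply: (@syzygyn_equiv 1); apply: stable_equiv_dsum.
Qed.

Lemma pd_le_short_exact q X P Z :
  is_projective P -> short_exact X P Z -> pd_le q X -> pd_le q.+1 Z.
Proof.
move=> hP ex; have [_ h] := short_exact_syzygyn (@pd_le_projective q _ hP) ex.
exact: projective_stable h.
Qed.
End Syzygies.

(** * Infima and suprema of extended naturals inside the extended rationals *)

Section ExtendedNaturals.
Local Open Scope ereal_scope.
Implicit Types (S : set nat) (E : set (\bar rat)).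

Definition enatural (x : \bar rat) : Prop :=
  x = +oo \/ exists n : nat, x = n%:R%:E.

(** Well-ordering of the naturals makes the infimum of a nonempty set a minimum. *)
Lemma einf_cases S : (exists n, [/\ S n, forall m, S m -> (n <= m)%N &
    einf S = n%:R%:E]) \/ (~ (exists n, S n)) /\ einf S = +oo.
Proof.
have [hS|hS] := pselect (exists n, S n); [left|right]; last first.
  split=> //; have -> : S = set0 by rewrite -subset0 => n Sn; case: hS; exists n.
  by rewrite /einf image_set0 ereal_inf0.
have ex : exists n, `[<S n>] by case: hS => n Sn; exists n; apply/asboolP.
case: (ex_minnP ex) => n /asboolP Sn mn.
have nS m : S m -> (n <= m)%N by move=> Sm; apply: mn; apply/asboolP.
exists n; split=> //; apply/eqP; rewrite eq_le; apply/andP; split; last first.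
  by apply: le_ereal_inf_tmp => _ [m /nS nm <-]; rewrite lee_fin ler_nat.
rewrite /einf /ereal_inf leeNl.
apply: ge_supremum_Nmem; last by exists (n%:R%:E) => //; exists n.
exists (- n%:R%:E); split=> [_ [_ [m /nS nm <-] <-]|y]; last first.
  by apply; exists (n%:R%:E) => //; exists n.
by rewrite leeN2 lee_fin ler_nat.
Qed.

Lemma einf_natural S : enatural (einf S).
Proof. by case: (einf_cases S) => [[n [_ _ ->]]|[_ ->]]; [right; exists n|left]. Qed.

Lemma einf_leP S n : einf S <= n%:R%:E <-> exists2 m, S m & (m <= n)%N.
Proof.
case: (einf_cases S) => [[m [Sm mS ->]]|[S0 ->]].
  rewrite lee_fin ler_nat; split=> [mn|[p Sp]]; first by exists m.
  by apply: leq_trans; apply: mS.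
by rewrite leye_eq; split=> // -[m Sm]; case: S0; exists m.
Qed.

Lemma einf_lt_pinfty S : einf S < +oo -> exists2 n, S n & einf S = n%:R%:E.
Proof. by case: (einf_cases S) => [[n [Sn _ ->]] _|[_ ->//]]; exists n. Qed.

Lemma le_einf S T : (forall n, T n -> S n) -> einf S <= einf T.
Proof.
move=> TS; case: (einf_cases T) => [[n [Tn _ ->]]|[_ ->]]; last exact: leey.
by apply/einf_leP; exists n => //; apply: TS.
Qed.

Lemma enatural_ge0 x : enatural x -> 0 <= x.
Proof. by case=> [->//|[n ->]]; rewrite lee_fin ler0n. Qed.

(** [\bar rat] is not complete, so [ereal_sup] can be trusted only where a least upper bound exists.
    For extended naturals it does: the largest element, or [+oo] for an unbounded set, by the
    Archimedean property. *)
Lemma esup_ubound E : (forall x, E x -> enatural x) ->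
  forall x, E x -> x <= ereal_sup E.
Proof.
move=> natE x Ex; apply: ge_supremum_Nmem (Ex).
have [Eoo|Eoo] := pselect (E +oo).
  by exists +oo; split=> [y _|y]; [rewrite leey|apply].
have Efin y : E y -> exists n : nat, y = n%:R%:E.
  by move=> Ey; case: (natE y Ey) => // yoo; rewrite yoo in Ey.
have [[N hN]|hN] := pselect (exists N : nat, forall n : nat, E n%:R%:E -> (n <= N)%N).
  have [n0 n0x] := Efin x Ex; rewrite {}n0x in Ex.
  have ex : exists n : nat, `[<E n%:R%:E>] by exists n0; apply/asboolP.
  have bd n : `[<E n%:R%:E>] -> (n <= N)%N by move=> /asboolP; exact: hN.
  case: (ex_maxnP ex bd) => m /asboolP Em mE.
  exists (m%:R%:E); split=> [y Ey|y]; last exact.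
  have [n e] := Efin y Ey; rewrite {}e in Ey *; rewrite lee_fin ler_nat.
  by apply: mE; apply/asboolP.
exists +oo; split=> [y _|y ub]; first by rewrite leey.
case: y ub => [r||] ub; rewrite ?lexx //; last first.
  by have := ub x Ex; have [n ->] := Efin x Ex.
case: hN; exists (Num.bound `|r|%R) => n En.
have := ub _ En; rewrite lee_fin => nr; rewrite -(ler_nat rat).
by apply: (le_trans nr); apply/ltW/(le_lt_trans (ler_norm r))/archi_boundP.
Qed.
End ExtendedNaturals.

(** * Delooping levels, resolutions and projective dimension *)

Section Levels.
Variables (K : fieldType) (A : falgType K).
Implicit Types X Y Z N P : rmodType A.
Local Open Scope ereal_scope.

Lemma dell_leP j X n : dell j X <= n%:R%:E <-> exists2 m, (m <= n)%N &
  exists Y, stable_retract (iter m (@syzygy _ _) X) (iter (m + j) (@syzygy _ _) Y).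
Proof. by rewrite /dell einf_leP; split=> -[m h h']; exists m. Qed.

(** A projective module is stably zero, hence a stable retract of any module. *)
Lemma dell_projective j P : is_projective P -> dell j P <= 0%:R%:E.
Proof.
move=> hP; apply/dell_leP; exists 0%N => //; exists P.
apply/stable_retractP; exists P => //.
exists (fun=> 0%R), (fun=> 0%R), id, (fun v => (- v)%R).
split; try exact: rlin_zero; first exact: rlin_id.
  exact: rlin_opp (rlin_id _).
by move=> v; rewrite subrr.
Qed.

Lemma ddell_natural k X : enatural (ddell k X).
Proof. exact: einf_natural. Qed.

(** The terms of a projective resolution have delooping level 0, so the resolution is admissible in
    the definition of [ddell]. *)
Lemma ddell_le_pd k X : ddell k X <= pd X.
Proof.
apply: le_einf => n [C hC pC]; exists n, C; split=> // i /pC.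
move=> /(dell_projective (i + k)).
by move=> /le_trans; apply; rewrite lee_fin ler_nat.
Qed.

Lemma ddell_alg_ge k (S : rmodType A) : is_simple S -> ddell k S <= ddell_alg k A.
Proof.
move=> sS; apply: esup_ubound; last by exists S.
by move=> _ [T _ ->]; apply: ddell_natural.
Qed.

Lemma lker_limg X Y Z (d : 'Hom(X, Y)) (e : 'Hom(Y, Z)) :
  lker e = limg d <-> forall y, e y = 0%R <-> exists x, d x = y.
Proof.
have img y : y \in limg d <-> exists x, d x = y.
  split=> [/memv_imgP[x _ ->]|[x <-]]; first by exists x.
  by rewrite memv_img ?memvf.
split=> [h y|h].
  by rewrite -img -h memv_ker; split=> [/eqP|/eqP].
apply/vspaceP=> y; rewrite memv_ker; apply/idP/idP=> [/eqP/h/img//|/img/h->].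
exact: eqxx.
Qed.

Lemma fullv_eq0 X : (fullv : {vspace X}) = 0%VS <-> forall v : X, v = 0%R.
Proof.
split=> [h v|h]; first by apply/eqP; rewrite -memv0 -h memvf.
by apply/vspaceP=> v; rewrite memvf memv0 (h v) eqxx.
Qed.

Lemma resolvesP X t (C : nat -> rmodType A) : resolves X t C <->
  (forall i, (t < i)%N -> forall v : C i, v = 0%R) /\
  exists (d : forall i, C i.+1 -> C i) (e : C 0%N -> X),
    [/\ forall i, rlin (d i), rlin e, onto e,
        forall y, e y = 0%R <-> exists x, d 0%N x = y &
        forall i y, d i y = 0%R <-> exists x, d i.+1 x = y].
Proof.
split=> [[h0 [d [e [hd he /limg_onto se /lker_limg ex0 ex]]]]|].
  split=> [i /h0/fullv_eq0//|]; exists d, e.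
  split=> // [i||i]; first exact: rlin_of_rhom.
    exact: rlin_of_rhom.
  by apply/lker_limg.
move=> [h0 [d [e [hd he se ex0 ex]]]]; split=> [i /h0/fullv_eq0//|].
pose d' i := s2val (cid2 (rhom_of_rlin (hd i))).
have rd' i : is_rhom (d' i) by rewrite /d'; case: cid2.
have ed' i : d' i =1 d i by rewrite /d'; case: cid2.
have [e' re' ee'] := rhom_of_rlin he.
exists d', e'; split=> //.
- by apply/limg_onto => y; have [x <-] := se y; exists x; rewrite ee'.
- apply/lker_limg => y; rewrite ee' ex0.
  by split=> -[x hx]; exists x; rewrite -hx ed'.
- move=> i; apply/lker_limg => y; rewrite ed' ex.
  by split=> -[x hx]; exists x; rewrite -hx ed'.
Qed.

(** Induction on the length, replacing [X] by the kernel of the augmentation. *)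
Lemma pd_le_resolves n X C : resolves X n C ->
  (forall i, (i <= n)%N -> is_projective (C i)) -> pd_le n X.
Proof.
elim: n X C => [|n IH] X C [h0 [d [e [hd he /limg_onto se ex0 ex]]]] hC.
  have sx := kernel_short_exact he se.
  have [f [g [hf hg injf sg exfg]]] := sx.
  (* [C 1] vanishes, so [lker e = limg (d 0)] is zero and [X] is isomorphic to [C 0]. *)
  have injg : injective g.
    move=> u v uv; apply/eqP; rewrite -subr_eq0; apply/eqP.
    have /exfg[[x hx] <-] : g (u - v)%R = 0%R by rewrite rlinB // uv subrr.
    apply/eqP; rewrite (_ : Subvs hx = 0%R) ?rlin0 //; apply: val_inj => /=.
    have := hx; rewrite ex0 => /memv_imgP[y _ ->].
    by rewrite ((fullv_eq0 (C 1%N)).1 (h0 1%N isT) y) linear0.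
  have [|v|s hs es] := @rlin_factor _ _ _ _ _ g (@id X) hg injg.
  - exact: rlin_id.
  - exact: sg.
  exact: projective_stable (retract_stable hs hg es) (hC 0%N isT).
(* The shifted complex resolves [lker e], with the corestriction of [d 0] as augmentation. *)
apply: pd_le_short_exact (hC 0%N isT) (kernel_short_exact he se) _.
apply: (IH _ (fun i => C i.+1)) => [|i iN]; last by apply: (hC i.+1).
apply/resolvesP; split=> [i ti|].
  by apply/fullv_eq0/h0.
have [f [g [hf hg injf sg exfg]]] := kernel_short_exact he se.
have hker : forall v : C 1%N, exists u, vsval (u : submod (lker_submod he)) = d 0%N v.
  move=> v; have hv : d 0%N v \in lker e by rewrite ex0 memv_img ?memvf.
  by exists (Subvs hv).
have [||d0 hd0 ed0] := @rlin_factor _ _ _ _ _ _ _ (rlin_vsval (lker_submod he)) _ _ hker.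
- exact: val_inj.
- exact: rlin_of_rhom.
exists (fun i => d i.+1), d0; split=> [i|||y|i].
- exact: rlin_of_rhom.
- exact: hd0.
- move=> [y hy]; have : y \in limg (d 0%N) by rewrite -ex0.
  case/memv_imgP=> x _ yx.
  by exists x; apply: val_inj; apply: etrans (ed0 x) (esym yx).
- rewrite -(lker_limg (d 1%N) (d 0%N)).1 // -ed0.
  by split=> [->|e0]; [rewrite linear0|apply: val_inj].
- exact/lker_limg.
Qed.

Lemma pd_finite X : pd X < +oo -> exists2 n : nat, pd X = n%:R%:E & pd_le n X.
Proof.
move=> /einf_lt_pinfty[n [C hC pC] e].
by exists n => //; apply: pd_le_resolves hC pC.
Qed.

(** Composing the augmentation with [f] turns a resolution of [X] into one of [Y] with the same
    terms. *)
Lemma ddell_iso k X Y (f : X -> Y) (g : Y -> X) :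
  rlin f -> rlin g -> cancel f g -> cancel g f -> ddell k Y <= ddell k X.
Proof.
move=> hf hg fg gf; apply: le_einf => m [t [C [tm /resolvesP[h0 hC] dC]]].
exists t, C; split=> //.
apply/resolvesP; split=> //.
have [d [e [hd he se ex0 ex]]] := hC.
exists d, (f \o e); split=> //; first exact: rlin_comp.
  by move=> y; have [x hx] := se (g y); exists x; rewrite /= hx gf.
move=> y; rewrite -ex0 /=; split=> [h|->]; last exact: rlin0.
by rewrite -[e y]fg h rlin0.
Qed.
End Levels.

(* Homomorphisms need not preserve the unit, so that [phi 1] is merely an
   idempotent.                                                               *)
Record nuhom (K : fieldType) (A' A : falgType K) := NuHom {
  nuhom_fun :> A' -> A;
  nuhom_linear : linear nuhom_fun;
  nuhomM : forall a b, nuhom_fun (a * b) = nuhom_fun a * nuhom_fun b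
}.

(** * The exact functor induced by a non-unital homomorphism, and its effect on levels *)

Section Restriction.
Variables (K : fieldType) (A' A : falgType K) (phi : nuhom A' A).
Implicit Types X Y Z N P : rmodType A.

(** As [phi 1] is idempotent, its fixed vectors are exactly the image [X . phi 1]. *)
Definition res_space X : {vspace X} := fixedSpace (linfun (ractr (phi 1))).

Lemma mem_res_space X (v : X) : (v \in res_space X) = (ract v (phi 1) == v).
Proof. by apply/fixedSpaceP/eqP; rewrite lfunE. Qed.

Fact res_act_mem X (v : subvs_of (res_space X)) a :
  ract (vsval v) (phi a) \in res_space X.
Proof. by rewrite mem_res_space -ractM -nuhomM mulr1. Qed.

Definition res_act X (v : subvs_of (res_space X)) a : subvs_of (res_space X) :=
  Subvs (res_act_mem v a).
Fact res_act_linearl X a : linear ((@res_act X)^~ a).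
Proof. by move=> k u v; apply: val_inj; rewrite /= [LHS](ract_linearl). Qed.
Fact res_act_linearr X v : linear (@res_act X v).
Proof. by move=> k a b; apply: val_inj; rewrite /= nuhom_linear linearP. Qed.
Fact res_act1 X v : @res_act X v 1 = v.
Proof. by apply: val_inj; apply/eqP; rewrite -mem_res_space subvsP. Qed.
Fact res_actM X v a b : @res_act X v (a * b) = res_act (res_act v a) b.
Proof. by apply: val_inj; rewrite /= nuhomM ractM. Qed.

(* The carrier is [X . phi 1]. *)
Definition resmod X : rmodType A' :=
  RModType (@res_act_linearl X) (@res_act_linearr X) (@res_act1 X) (@res_actM X).

Lemma res_fix X (v : resmod X) : ract (vsval v) (phi 1) = vsval v.
Proof. by apply/eqP; rewrite -mem_res_space subvsP. Qed.

(** Only the values on vectors fixed by [phi 1] matter; elsewhere this is a projection along a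
    chosen complement. *)
Definition to_res X (v : X) : resmod X := vsproj (res_space X) v.

Lemma to_resK X (v : X) : ract v (phi 1) = v -> vsval (to_res v) = v.
Proof. by move/eqP; rewrite -mem_res_space; exact: vsprojK. Qed.

Lemma to_res_ract X (v : X) : vsval (to_res (ract v (phi 1))) = ract v (phi 1).
Proof. by apply: to_resK; rewrite -ractM -nuhomM mulr1. Qed.

(** A map semilinear over [phi] lands in the restriction automatically:
    [f v = f (v . 1) = f v . phi 1]. *)
Lemma rlin_into_res X (Z : rmodType A') (f : Z -> X) : linear f ->
    (forall v a, f (ract v a) = ract (f v) (phi a)) ->
  rlin (fun v => to_res (f v)) /\ forall v, vsval (to_res (f v)) = f v.
Proof.
move=> lf hf.
have E v : vsval (to_res (f v)) = f v by rewrite to_resK // -hf ract1.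
split=> //; split=> [k u v|v a]; apply: val_inj; apply: etrans (E _) _.
  by rewrite lf -{1}(E u) -{1}(E v).
by rewrite hf -{1}(E v).
Qed.

Definition res_map X Y (f : X -> Y) (v : resmod X) : resmod Y :=
  to_res (f (vsval v)).

Lemma res_map_spec X Y (f : X -> Y) : rlin f ->
  rlin (res_map f) /\ forall v, vsval (res_map f v) = f (vsval v).
Proof.
move=> hf; apply: rlin_into_res => [k u v|v a]; first by rewrite -hf.1.
by rewrite -hf.2.
Qed.

Lemma res_map_rlin X Y (f : X -> Y) : rlin f -> rlin (res_map f).
Proof. by case/res_map_spec. Qed.

Lemma res_mapE X Y (f : X -> Y) (hf : rlin f) v :
  vsval (res_map f v) = f (vsval v).
Proof. by have [_ ->] := res_map_spec hf. Qed.

Lemma res_map_onto X Y (f : X -> Y) : rlin f -> onto f -> onto (res_map f).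
Proof.
move=> hf sf y; have [x hx] := sf (vsval y).
(* The preimage [x] need not be fixed by [phi 1]. Acting with [phi 1] moves it into the restriction
   and leaves its image, which is already fixed, unchanged. *)
exists (to_res (ract x (phi 1))); apply: val_inj.
by apply: etrans (res_mapE hf _) _; rewrite to_res_ract hf.2 hx res_fix.
Qed.

Lemma res_map_exact X Y Z (f : X -> Y) (g : Y -> Z) : rlin f -> rlin g ->
    (forall y, g y = 0 <-> exists x, f x = y) ->
  forall y, res_map g y = 0 <-> exists x, res_map f x = y.
Proof.
move=> hf hg ex y; split=> [gy|[x <-]]; last first.
  apply: val_inj; apply: etrans (res_mapE hg _) _; rewrite (res_mapE hf).
  by apply/ex; exists (vsval x).
have /ex[x hx] : g (vsval y) = 0 by rewrite -(res_mapE hg) gy.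
exists (to_res (ract x (phi 1))); apply: val_inj.
by apply: etrans (res_mapE hf _) _; rewrite to_res_ract hf.2 hx res_fix.
Qed.

Lemma short_exact_res X Y Z :
  short_exact X Y Z -> short_exact (resmod X) (resmod Y) (resmod Z).
Proof.
move=> [f [g [hf hg injf sg ex]]]; exists (res_map f), (res_map g); split.
- exact: res_map_rlin.
- exact: res_map_rlin.
- move=> u v uv; apply/val_inj/injf.
  by rewrite -[LHS](res_mapE hf) uv (res_mapE hf).
- exact: res_map_onto.
exact: res_map_exact.
Qed.

Lemma retract_mod_res N X Y :
  retract_mod N X Y -> retract_mod (resmod N) (resmod X) (resmod Y).
Proof.
move=> [i [r [g [h [hi hr hg hh e]]]]].
exists (res_map i), (res_map r), (res_map g), (res_map h).
split; try exact: res_map_rlin.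
move=> v; apply: val_inj; apply: etrans (res_mapE hr _) _.
by rewrite (res_mapE hi) e -(res_mapE hg) -(res_mapE hh).
Qed.

Lemma resolves_res X t (C : nat -> rmodType A) :
  resolves X t C -> resolves (resmod X) t (fun i => resmod (C i)).
Proof.
move=> /resolvesP[h0 [d [e [hd he se ex0 ex]]]]; apply/resolvesP; split.
  by move=> i /h0 C0 v; apply: val_inj; apply: C0.
exists (fun i => res_map (d i)), (res_map e); split=> [i||||i].
- exact: res_map_rlin.
- exact: res_map_rlin.
- exact: res_map_onto.
- exact: res_map_exact.
- exact: res_map_exact.
Qed.

Section Bound.
Variable q : nat.
Hypothesis hq : pd_le q (resmod (regmod A)).

(** Induction on the rank: dropping the first coordinate leaves an error through [regmod A], whose
    restriction is bounded by [hq]. *)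
Lemma pd_le_res_free n : pd_le q (resmod (powmod (regmod A) n)).
Proof.
elim: n => [|n IH].
  apply: pd_le_stable (hq); apply: (@retract_stable _ _ _ _ (fun=> 0) (fun=> 0)).
  - exact: rlin_zero.
  - exact: rlin_zero.
  - by move=> v; apply: val_inj; apply/ffunP; case.
apply: (pd_le_retract_mod hq IH); apply: retract_mod_res.
pose F m := powmod (regmod A) m.
exists (fun v : F n.+1 => [ffun i => v (lift ord0 i)] : F n).
exists (fun v : F n => [ffun i => if unlift ord0 i is Some j then v j else 0] : F n.+1).
exists (fun v : F n.+1 => v ord0 : regmod A).
exists (fun a : regmod A => [ffun i => if i == ord0 then - a else 0] : F n.+1).
split.
- by split=> [k u v|v a]; apply/ffunP=> i; rewrite !ffunE.
- split=> [k u v|v a]; apply/ffunP=> i; rewrite !ffunE.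
    by case: unliftP => [j _|_]; rewrite ?ffunE ?scaler0 ?addr0.
  by case: unliftP => [j _|_]; rewrite ?ffunE ?ract0.
- by split=> [k u v|v a]; rewrite ?ffunE.
- split=> [k u v|v a]; apply/ffunP=> i; rewrite !ffunE.
    by case: eqP => _; rewrite ?opprD ?scalerN ?scaler0 ?addr0.
  by case: eqP => _; rewrite ?ractN ?ract0.
move=> v; apply/ffunP=> i; rewrite !ffunE; case: unliftP => [j ->|->].
  by rewrite ffunE eq_sym (negPf (neq_lift _ _)) addr0.
by rewrite eqxx subrr.
Qed.

Lemma pd_le_res_projective P : is_projective P -> pd_le q (resmod P).
Proof.
move=> hP; have [_ [p [_ hp _ sp _]]] := syzygy_short_exact P.
have [s hs ps] := (projective_lift P).1 hP _ _ p id hp (rlin_id P) sp.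
apply: pd_le_stable _ (@pd_le_res_free (\dim {:P})).
apply: (retract_stable (res_map_rlin hs) (res_map_rlin hp)) => v.
by apply: val_inj; rewrite -[LHS]/(vsval _) (res_mapE hp) (res_mapE hs) ps.
Qed.

(** A restricted free cover need not be projective, but it satisfies [pd_le q]; so restriction
    commutes with syzygies once [q] further syzygies are taken. *)
Lemma syzygyn_res n X :
  stable_equiv (iter q (@syzygy _ _) (resmod (iter n (@syzygy _ _) X)))
               (iter (n + q) (@syzygy _ _) (resmod X)).
Proof.
elim: n => [|n IH] //=; first by split; apply: stable_refl.
have ex := short_exact_res (syzygy_short_exact (iter n (@syzygy _ _) X)).
apply: stable_equiv_trans (short_exact_syzygyn (@pd_le_res_free _) ex) _.
exact: (@syzygyn_equiv _ _ 1 _ _ IH).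
Qed.

(** Both sides of the retract move by the same [q] syzygies, so the gap [j] is kept while the level
    grows by [q]. *)
Lemma dell_res j X n :
  (dell j X <= n%:R%:E -> dell j (resmod X) <= (n + q)%:R%:E)%E.
Proof.
move=> /dell_leP[m mn [Y /stable_retractP[P hP /retract_mod_res rXY]]].
apply/dell_leP; exists (m + q)%N; first by rewrite leq_add2r.
exists (resmod Y); rewrite addnAC.
have [_ h1] := syzygyn_res m X; have [h2 _] := syzygyn_res (m + j) Y.
apply: stable_trans h1 (stable_trans _ h2).
exact: syzygyn_retract_mod (pd_le_res_projective hP) rXY.
Qed.

(** Exactness carries the sequence over with the same [t]. As [i <= t <= n], no subtraction is
    truncated and [(n - i) + q = (n + q) - i]. *)
Lemma ddell_res k X : (ddell k (resmod X) <= q%:R%:E + ddell k X)%E.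
Proof.
have [->|[m e]] := ddell_natural k X; first by rewrite addey ?leey.
have /einf_leP[n [t [C [tn hC dC]]] nm] : (ddell k X <= m%:R%:E)%E by rewrite e.
rewrite e -EFinD -natrD; apply/einf_leP; exists (n + q)%N; last first.
  by rewrite addnC leq_add2l.
exists t, (fun i => resmod (C i)); split.
- exact: leq_trans (leq_addr _ _).
- exact: resolves_res.
move=> i it; rewrite -addnBAC ?(leq_trans it) //; exact/dell_res/dC.
Qed.
End Bound.
End Restriction.

(** * Recovering a module from its double restriction *)

Section Inverse.
Variables (K : fieldType) (A' A : falgType K).
Variables (psi : nuhom A' A) (phi : nuhom A A') (X : rmodType A).
Hypothesis psi_phi : forall (v : X) a, ract v (psi (phi a)) = ract v a.

(** [psi (phi 1)] acts as the identity and absorbs [psi 1] on the right. *)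
Lemma ract_psi1 (v : X) : ract v (psi 1) = v.
Proof.
by rewrite -{1}[v]ract1 -(psi_phi v 1) -ractM -nuhomM mulr1 psi_phi ract1.
Qed.

(** Both idempotents act as the identity, so the double restriction is isomorphic to [X]. *)
Lemma ddell_le_res_res k : (ddell k X <= ddell k (resmod phi (resmod psi X)))%E.
Proof.
have Ev (v : X) : vsval (to_res psi v) = v by apply/to_resK/ract_psi1.
have lin : linear (@to_res _ _ _ psi X).
  by move=> c u v; rewrite /to_res linearP.
have [|hf Ef] := @rlin_into_res _ _ _ phi _ X (@to_res _ _ _ psi X) lin.
  by move=> v a; apply: val_inj; rewrite [LHS]Ev /= Ev psi_phi.
pose f (w : resmod phi (resmod psi X)) : X := vsval (vsval w).
apply: (@ddell_iso _ _ _ _ _ f _ _ hf) => [|w|v].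
- by split=> // w a; rewrite -[in RHS]psi_phi.
- by apply/val_inj; apply: etrans (Ef _) _; apply/val_inj; apply: Ev.
- by apply: etrans (congr1 vsval (Ef v)) _; apply: Ev.
Qed.

(** Each [a] acts on [X] as [psi (phi a)], so submodules of the restriction are already submodules
    of [X]. *)
Lemma simple_res : is_simple X -> is_simple (resmod psi X).
Proof.
have Ev (v : X) : vsval (to_res psi v) = v by apply/to_resK/ract_psi1.
move=> [X0 sX]; split=> [E0|U sU].
  apply: X0; apply/fullv_eq0 => v; rewrite -(Ev v).
  by rewrite ((fullv_eq0 (resmod psi X)).1 E0 (to_res psi v)) linear0.
pose f : 'Hom(resmod psi X, X) := linfun vsval.
have fE v : f v = vsval v by rewrite lfunE.
have sW : is_submod (f @: U)%VS.
  move=> _ a /memv_imgP[u uU ->]; rewrite -psi_phi fE.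
  by have := memv_img f (sU u (phi a) uU); rewrite fE.
have injf v : (v \in U) = (vsval v \in (f @: U)%VS).
  rewrite -fE; apply/idP/idP=> [|/memv_imgP[u uU]]; first exact: memv_img.
  by rewrite !fE => /val_inj->.
have [h|h] := sX _ sW; [left|right]; apply/vspaceP=> v; rewrite injf h.
  by rewrite !memv0; apply/eqP/eqP=> [e|->]; [apply: val_inj|rewrite linear0].
by rewrite !memvf.
Qed.
End Inverse.

(* Without simple modules, the supremum [ddell_alg k A] would be [-oo]. *)
Lemma simple_exists (K : fieldType) (A : falgType K) :
  exists S : rmodType A, is_simple S.
Proof.
pose P n := `[<exists U : {vspace regmod A},
  [/\ is_submod U, U <> 0%VS & \dim U = n]>].
have exP : exists n, P n.
  exists (\dim (fullv : {vspace regmod A})); apply/asboolP; exists fullv.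
  split=> // [v a _|]; first exact: memvf.
  by move/fullv_eq0/(_ (1 : A))/eqP; rewrite oner_eq0.
case: (ex_minnP exP) => n /asboolP[U [sU U0 <-]] minU.
exists (submod sU); split=> [/fullv_eq0 E0|W sW].
  apply: U0; apply/vspaceP=> v; rewrite memv0; apply/idP/eqP=> [vU|->].
    by have := congr1 (@vsval _ _ U) (E0 (Subvs vU)).
  exact: mem0v.
pose f : 'Hom(submod sU, regmod A) := linfun vsval.
have fE v : f v = vsval v by rewrite lfunE.
have injf v : (v \in W) = (vsval v \in (f @: W)%VS).
  rewrite -fE; apply/idP/idP=> [|/memv_imgP[u uU]]; first exact: memv_img.
  by rewrite !fE => /val_inj->.
have sfW : is_submod (f @: W)%VS.
  move=> _ a /memv_imgP[u uW ->]; rewrite fE.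
  by have := memv_img f (sW u a uW); rewrite fE.
have fWU : (f @: W <= U)%VS.
  by apply/subvP=> _ /memv_imgP[u _ ->]; rewrite fE subvsP.
have [W0|/eqP W0] := eqVneq (f @: W)%VS 0%VS; [left|right]; apply/vspaceP=> v; rewrite injf.
  by rewrite W0 !memv0; apply/eqP/eqP=> [e|->]; [apply: val_inj|rewrite linear0].
rewrite memvf; have /eqP-> : (f @: W)%VS == U; last exact: subvsP.
by rewrite eqEdim fWU minU //; apply/asboolP; exists (f @: W)%VS.
Qed.

(** * Modules over the triangular algebra and their simple modules *)

Section TriangularModules.
Variables (K : fieldType) (A B : falgType K) (M : bimodType B A).
Let Lam : falgType K := trimx M.

Lemma lact0 b : lact b (0 : M) = 0.
Proof. exact: linear0. Qed.

Lemma lact0l (m : M) : lact 0 m = 0.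
Proof. by rewrite -[LHS]/(lactr m 0) linear0. Qed.

Lemma ract0r (N : rmodType A) (m : N) : ract m 0 = 0.
Proof. exact: linear0. Qed.

(** Its value at 1 is the idempotent [e_A = (1, 0, 0)], so restriction along it is [X . e_A]. *)
Definition inA_fun (a : A) : Lam := (a, 0, 0).
Fact inA_linear : linear inA_fun.
Proof. by move=> k a b; congr (_, _, _); rewrite /= ?scaler0 ?addr0. Qed.
Fact inA_mul a b : inA_fun (a * b) = inA_fun a * inA_fun b.
Proof. by congr (_, _, _); rewrite /= ?lact0 ?ract0 ?addr0 ?mulr0. Qed.
Definition inA : nuhom A Lam := NuHom inA_linear inA_mul.

Definition inB_fun (b : B) : Lam := (0, 0, b).
Fact inB_linear : linear inB_fun.
Proof. by move=> k a b; congr (_, _, _); rewrite /= ?scaler0 ?addr0. Qed.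
Fact inB_mul a b : inB_fun (a * b) = inB_fun a * inB_fun b.
Proof. by congr (_, _, _); rewrite /= ?lact0 ?ract0 ?addr0 ?mulr0. Qed.
Definition inB : nuhom B Lam := NuHom inB_linear inB_mul.

Definition prA_fun (x : Lam) : A := x.1.1.
Fact prA_linear : linear prA_fun.
Proof. by []. Qed.
Fact prA_mul x y : prA_fun (x * y) = prA_fun x * prA_fun y.
Proof. by []. Qed.
Definition prA : nuhom Lam A := NuHom prA_linear prA_mul.

Definition prB_fun (x : Lam) : B := x.2.
Fact prB_linear : linear prB_fun.
Proof. by []. Qed.
Fact prB_mul x y : prB_fun (x * y) = prB_fun x * prB_fun y.
Proof. by []. Qed.
Definition prB : nuhom Lam B := NuHom prB_linear prB_mul.

(** The second column of [Lam] is [B] alone, the regular [B]-module. *)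
Lemma projective_res_inB : pd_le 0 (resmod inB (regmod Lam)).
Proof.
have [||hr Er] := @rlin_into_res _ _ _ inB (regmod Lam) (regmod B)
   (fun b => (0, 0, b) : Lam).
- by move=> k u v; congr (_, _, _); rewrite /= ?scaler0 ?addr0.
- by move=> u b; congr (_, _, _); rewrite /= ?lact0 ?ract0 ?addr0 ?mulr0.
have hi : rlin (fun v : resmod inB (regmod Lam) => (vsval v : Lam).2 : regmod B).
  by split=> // k u v; rewrite linearP.
apply: projective_stable (retract_stable hi hr _) (@projective_reg _ B) => v.
apply: val_inj; rewrite [LHS]Er -[RHS](res_fix v).
by congr (_, _, _); rewrite /= ?lact0 ?ract0r ?addr0 ?mulr0 ?mulr1.
Qed.

Lemma rlin_unres_prA :
  rlin (fun v : resmod prA (regmod A) => (vsval v, 0, 0) : regmod Lam).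
Proof.
split=> [k u v|v x]; congr (_, _, _);
by rewrite /= ?scaler0 ?addr0 ?ract0 ?lact0l ?addr0 ?mul0r.
Qed.

(** Inflated along [prA], [A] is the first row of [Lam], a direct summand of the regular module. *)
Lemma projective_res_prA : pd_le 0 (resmod prA (regmod A)).
Proof.
have [||hr Er] := @rlin_into_res _ _ _ prA (regmod A) (regmod Lam)
   (fun x => (x : Lam).1.1) => //.
apply: projective_stable (retract_stable rlin_unres_prA hr _) (@projective_reg _ Lam) => v.
by apply: val_inj; rewrite [LHS]Er.
Qed.

(** The case [q = 0] of [syzygyn_res]: inflation preserves projectives and commutes stably with
    syzygies. *)
Lemma pd_le_res_prA p (N : rmodType A) : pd_le p N -> pd_le p (resmod prA N).
Proof.
move=> hN; have [_ h] := syzygyn_res projective_res_prA p N.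
rewrite addn0 in h; apply: projective_stable h _.
exact: (@pd_le_res_projective _ _ _ _ 0%N projective_res_prA _ hN).
Qed.

(** The first column of [Lam] is the direct sum of [A] and [M] as an [A]-module; the coordinate in
    [A] serves as the error term. *)
Lemma pd_le_res_inA p : pd_le p M -> pd_le p (resmod inA (regmod Lam)).
Proof.
move=> hM; apply: pd_le_retract_mod (pd_le_projective (@projective_reg _ A)) hM _.
have fixA (v : resmod inA (regmod Lam)) : (vsval v : Lam).2 = 0.
  by rewrite -(res_fix v) /= mulr0.
have [||hr Er] := @rlin_into_res _ _ _ inA (regmod Lam) M
   (fun m => (0, m, 0) : Lam).
- by move=> k u v; congr (_, _, _); rewrite /= ?scaler0 ?addr0.
- by move=> u b; congr (_, _, _); rewrite /= ?lact0 ?addr0 ?mul0r.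
have [||hh Eh] := @rlin_into_res _ _ _ inA (regmod Lam) (regmod A)
   (fun a => (- a, 0, 0) : Lam).
- by move=> k u v; congr (_, _, _); rewrite /= ?scaler0 ?addr0 ?opprD ?scalerN.
- by move=> u b; congr (_, _, _); rewrite /= ?lact0 ?ract0 ?addr0 ?mul0r ?mulNr.
exists (fun v : resmod inA (regmod Lam) => (vsval v : Lam).1.2 : M).
exists (fun m => @to_res _ _ _ inA (regmod Lam) (0, m, 0)).
exists (fun v : resmod inA (regmod Lam) => (vsval v : Lam).1.1 : regmod A).
exists (fun a => @to_res _ _ _ inA (regmod Lam) (- a, 0, 0)).
split; [|exact: hr| |exact: hh|].
- split=> [k u v|v a]; first by rewrite linearP.
  by rewrite /= lact0 addr0.
- by split=> [k u v|v a]; first by rewrite linearP.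
move=> v; apply: val_inj; rewrite [LHS]Er.
apply: (@etrans _ _ (vsval v + (- (vsval v : Lam).1.1, 0, 0) : Lam)); last first.
  by rewrite -[in LHS](Eh (vsval v : Lam).1.1).
have := fixA v; case: (vsval v) => [[a m] b] /= ->.
by congr (_, _, _); rewrite /= ?subrr ?addr0.
Qed.

(** The kernel of [Lam -> B] is the first column, which as a right [Lam]-module is the direct sum of
    [A] and [M] inflated along [prA]. Passing to this kernel costs the extra syzygy. *)
Lemma pd_le_res_prB p : pd_le p M -> pd_le p.+1 (resmod prB (regmod B)).
Proof.
move=> hM.
have [||hf Ef] := @rlin_into_res _ _ _ prB (regmod B) (regmod Lam)
   (fun x => (x : Lam).2) => //.
have [f rf ef] := rhom_of_rlin hf.
have sf : onto f.
  move=> b; exists ((0, 0, vsval b) : Lam); rewrite ef; apply: val_inj.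
  exact: Ef.
apply: pd_le_short_exact (@projective_reg _ Lam) (kernel_short_exact rf sf) _.
set N := submod _.
have Nval (v : N) : (vsval v : Lam).2 = 0.
  have : vsval v \in lker f := subvsP v.
  by rewrite memv_ker ef => /eqP e; rewrite -Ef e.
have memN (x : Lam) : x.2 = 0 -> exists u : N, vsval u = x.
  move=> x2; have hx : x \in lker f.
    by rewrite memv_ker ef; apply/eqP/val_inj; rewrite [LHS]Ef x2.
  by exists (Subvs hx).
have pA : pd_le p (resmod prA (regmod A)).
  exact/pd_le_projective/projective_res_prA.
apply: pd_le_retract_mod pA (pd_le_res_prA hM) _.
have [||hi Ei] := @rlin_into_res _ _ _ prA M N (fun v => (vsval v : Lam).1.2).
- by move=> k u v; rewrite linearP.
- by move=> v x; rewrite /= Nval lact0l addr0.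
have [||hg Eg] := @rlin_into_res _ _ _ prA (regmod A) N
  (fun v => (vsval v : Lam).1.1).
- by move=> k u v; rewrite linearP.
- by [].
have [|||r hr er] := @rlin_factor _ _ (resmod prA M) N (regmod Lam) vsval
  (fun w => (0, vsval w, 0) : Lam) (rlin_vsval _).
- exact: val_inj.
- split=> [k u v|v x]; congr (_, _, _);
  by rewrite /= ?scaler0 ?addr0 ?lact0l ?addr0 ?mul0r ?linearP.
- by move=> w; apply: memN.
have [|||h hh eh] := @rlin_factor _ _ (resmod prA (regmod A)) N (regmod Lam) vsval
  (fun w => - ((vsval w, 0, 0) : Lam)) (rlin_vsval _).
- exact: val_inj.
- exact: rlin_opp rlin_unres_prA.
- by move=> w; apply: memN; rewrite /= oppr0.
exists (fun v : N => @to_res _ _ _ prA M (vsval v : Lam).1.2), r.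
exists (fun v : N => @to_res _ _ _ prA (regmod A) (vsval v : Lam).1.1), h.
split; [exact: hi|exact: hr|exact: hg|exact: hh|].
move=> v; apply: val_inj; rewrite [LHS]er Ei.
apply: etrans _ (esym (rlinD (rlin_vsval (lker_submod rf)) _ _)).
rewrite eh Eg; have := Nval v; case: (vsval v) => [[a m] b] /= ->.
by congr (_, _, _); rewrite /= ?subrr ?subr0.
Qed.

(** [S] inflated along [prA] is a simple [Lam]-module, and restriction along [inA] recovers it at
    cost [p]. *)
Lemma ddell_A_le k p (S : rmodType A) : is_simple S -> pd_le p M ->
  (ddell k S <= p%:R%:E + ddell_alg k Lam)%E.
Proof.
move=> sS hM.
have sV : is_simple (resmod prA S) by apply: (@simple_res _ _ _ prA inA).
have h : forall (v : S) a, ract v (prA (inA a)) = ract v a by [].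
apply: (le_trans (ddell_le_res_res h k)).
apply: (le_trans (ddell_res (pd_le_res_inA hM) k _)).
by rewrite leeD2l // ddell_alg_ge.
Qed.

(** Inflation along [prB] is undone by [inB] at no cost. Nonnegativity is recorded for the
    arithmetic of (a); the inflated simple module witnesses it. *)
Lemma ddell_B_le k (T : rmodType B) : is_simple T ->
  (0 <= ddell_alg k Lam)%E /\ (ddell k T <= ddell_alg k Lam)%E.
Proof.
move=> sT.
have sV : is_simple (resmod prB T) by apply: (@simple_res _ _ _ prB inB).
have h : forall (v : T) a, ract v (prB (inB a)) = ract v a by [].
have hV := ddell_alg_ge k sV.
split; first exact: le_trans (enatural_ge0 (ddell_natural k _)) hV.
apply: (le_trans (ddell_le_res_res h k)).
apply: (le_trans (ddell_res projective_res_inB k _)).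
by rewrite add0e.
Qed.

(** Since [e_A x = e_A x e_A] for all [x], the subspace [V . e_A] is a submodule. It is zero or [V],
    and [V] is accordingly inflated from [B] or from [A]. *)
Lemma ddell_trimx_simple k (V : rmodType Lam) : is_simple V ->
  (exists2 S : rmodType A, is_simple S & (ddell k V <= ddell k S)%E) \/
  (exists2 T : rmodType B, is_simple T & forall p, pd_le p M ->
     (ddell k V <= p.+1%:R%:E + ddell k T)%E).
Proof.
move=> sV; have subU : is_submod (res_space inA V).
  move=> v x; rewrite !mem_res_space => /eqP <-; rewrite -!ractM.
  apply/eqP; congr (ract v _).
  by congr (_, _, _); rewrite /= ?lact0 ?lact0l ?ract0 ?addr0 ?mulr0 ?mulr1 ?mul1r ?mul0r.
have [U0|UV] := sV.2 _ subU.
  have h (v : V) x : ract v (inB (prB x)) = ract v x.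
    (* [y e_A = y], so [v . y] lies in [V . e_A = 0] and only the entry of [x] in [B] acts. *)
    pose y : Lam := (x.1.1, x.1.2, 0).
    have -> : ract v x = ract v y + ract v (inB (prB x)).
      rewrite -linearD; congr (ract v _); case: x @y => [[a m] b].
      by congr (_, _, _); rewrite /= ?addr0 ?add0r.
    have : ract v y \in res_space inA V.
      rewrite mem_res_space -ractM; apply/eqP; congr (ract v _).
      by congr (_, _, _); rewrite /= ?lact0 ?ract1 ?addr0 ?mulr0 ?mulr1.
    by rewrite U0 memv0 => /eqP->; rewrite add0r.
  right; exists (resmod inB V); first exact: simple_res h sV.
  move=> p hM; apply: (le_trans (ddell_le_res_res h k)).
  exact: ddell_res (pd_le_res_prB hM) k _.
(* Here [e_A] acts as the identity, and [e_A x = inA (prA x)]. *)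
have h (v : V) x : ract v (inA (prA x)) = ract v x.
  have /eqP e : ract v (inA 1) == v by rewrite -mem_res_space UV memvf.
  rewrite -[in RHS]e -ractM; congr (ract v _).
  by congr (_, _, _); rewrite /= ?mul1r ?ract0 ?lact0l ?addr0 ?mul0r.
left; exists (resmod inA V); first exact: simple_res h sV.
apply: (le_trans (ddell_le_res_res h k)).
by apply: (le_trans (ddell_res projective_res_prA k _)); rewrite add0e.
Qed.
End TriangularModules.

(** Weakens [ddell_alg k B <= ddell_alg k Lam] to the form of (a), using only that the factor is at
    least 1. *)
Lemma le_muleD1B1 (x : \bar rat) (n : nat) :
  (0 <= x -> x <= (1 + n)%N%:R%:E * (x + 1) - 1)%E.
Proof.
case: x => [r||] //; last first.
  by move=> _; rewrite addye // gt0_muley ?lte_fin ?ltr0n // leey.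
rewrite -EFinD !lee_fin => r0.
by rewrite lerBrDr ler_peMl ?addr_ge0 ?ler1n.
Qed.

Theorem corollary5p7 (K : closedFieldType) (A B : falgType K)
    (M : bimodType B A) (k : nat) (hk : (0 < k)%N) :
  let L := (1 + max_tensor_length M)%N in
  let Lam : falgType K := trimx M in
  [/\ (ddell_alg k B <= L%:R%:E * (ddell_alg k Lam + 1) - 1)%E,
      (pd M < +oo)%E ->
        (ddell_alg k A <= pd M + ddell_alg k Lam)%E,
      (pd M < +oo)%E ->
        (ddell_alg k Lam
           <= maxe (ddell_alg k A) (pd M + 1 + ddell_alg k B))%E &
      (gldim A <= 1)%E ->
        (ddell_alg k Lam <= ddell_alg k B + 2%:R%:E)%E].
Proof.
move=> L Lam; split.
- apply: ge_ereal_sup => _ [T sT ->]; have [ge0 le] := ddell_B_le M k sT.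
  exact: le_trans le (le_muleD1B1 _ ge0).
- move=> /pd_finite[p -> hM]; apply: ge_ereal_sup => _ [S sS ->].
  exact: ddell_A_le.
- move=> /pd_finite[p -> hM]; apply: ge_ereal_sup => _ [V sV ->].
  rewrite le_max; case: (ddell_trimx_simple k sV) => [[S sS]|[T sT /(_ p hM)]] h.
    by rewrite (le_trans h) ?ddell_alg_ge.
  apply/orP; right; apply: (le_trans h); rewrite -EFinD natr1.
  by rewrite leeD2l // ddell_alg_ge.
move=> gl; have pdA (N : rmodType A) : (pd N <= 1)%E.
  apply: le_trans gl; apply: esup_ubound; last by exists N.
  by move=> _ [X ->]; apply: einf_natural.
have [p ep hM] : exists2 p : nat, (p <= 1)%N & pd_le p M.
  have [|p ep hM] := @pd_finite _ _ M; first by rewrite (le_lt_trans (pdA M)) ?ltry.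
  by exists p => //; have := pdA M; rewrite ep lee_fin (ler_nat _ p 1).
apply: ge_ereal_sup => _ [V sV ->].
case: (ddell_trimx_simple k sV) => [[S sS]|[T sT /(_ p hM)]] h.
  (* A simple [A]-module contributes at most 1, which is below the bound because any simple
     [B]-module shows that [ddell_alg k B] is nonnegative. *)
  apply: (le_trans h); apply: (le_trans (ddell_le_pd k S)); apply: (le_trans (pdA S)).
  have [T sT] := simple_exists B.
  apply: (@le_trans _ _ (0 + 2%:R%:E)%E); first by rewrite add0e lee_fin (ler_nat _ 1 2).
  rewrite leeD2r //; apply: le_trans (ddell_alg_ge k sT).
  exact/enatural_ge0/ddell_natural.
apply: (le_trans h); rewrite addeC; apply: leeD; first exact: ddell_alg_ge.
by rewrite lee_fin ler_nat.
Qed.
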